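(* Let $\lambda,\mu\in DP$ with $D_\mu\subseteq D_\lambda$ and let $b\ge\ell(\lambda)$. Let $(a,b-1)$ be the uppermost box of $D_{\lambda/\mu}$ in the $(b-1)$-th column. Let $\Gamma^{\downarrow}_b(D_{\lambda/\mu})$ be the diagram obtained from $D_{\lambda/\mu}$ by shifting all boxes $(x,y)$ with $y<b$ one box down, and let $\alpha,\beta\in DP$ be such that $\Gamma^{\downarrow}_b(D_{\lambda/\mu})\cup\{(a,b-1)\}$ has shape $D_{\alpha/\beta}$. Then for every $\nu\in DP$ $$f^{\lambda}_{\mu\nu}\le f^{\alpha}_{\beta,\,\nu+(1)}.$$
   Context: $DP$ is the set of all partitions with distinct parts, i.e. finite strictly decreasing sequences $\lambda=(\lambda_1>\cdots>\lambda_{\ell(\lambda)}>0)$ of integers, including $\emptyset$. The (shifted) diagram is $D_\lambda=\{(i,j)\mid 1\le i\le \ell(\lambda),\ i\le j\le i+\lambda_i-1\}$ (matrix coordinates: first coordinate is the row, counted downwards); if $D_\mu\subseteq D_\lambda$, $D_{\lambda/\mu}=D_\lambda\setminus D_\mu$. A set of boxes has shape $D_{\alpha/\beta}$ if it equals $D_{\alpha/\beta}$ up to a translation. For $\nu\in DP$, $\nu+(1)=(\nu_1+1,\nu_2,\ldots,\nu_{\ell(\nu)})$ (and $\emptyset+(1)=(1)$). Alphabet: $1'<1<2'<2<\cdots$. A tableau of shape $D_{\lambda/\mu}$ is a filling of the boxes by letters of this alphabet, weakly increasing along rows (left to right) and down columns, such that each column contains at most one unmarked $k$ and each row at most one marked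 $k'$, for every $k\ge 1$. Its content $c(T)=(c_1,c_2,\ldots)$ (trailing zeros omitted) has $c_i$ = total number of entries $i$ and $i'$. Amenability: the reading word $w(T)$ reads the rows from left to right, starting with the bottom row and ending with the top row. For a word $w=w_1\cdots w_n$ in the alphabet and $i\ge1$ set $m_i(0)=0$; for $1\le j\le n$, $m_i(j)$ is the number of letters $i$ in $w_{n-j+1}\cdots w_n$; for $n+1\le j\le 2n$, $m_i(j)=m_i(n)+$ the number of letters $i'$ in $w_1\cdots w_{j-n}$. The word is $k$-amenable if: (a) for $0\le j\le n-1$, if $m_k(j)=m_{k-1}(j)$ then $w_{n-j}\notin\{k,k'\}$; (b) for $n\le j\le 2n-1$, if $m_k(j)=m_{k-1}(j)$ then $w_{j-n+1}\notin\{k-1,k'\}$; (c) the leftmost letter of $w$ in $\{k',k\}$, if any, is $k$; (d) the leftmost letter of $w$ in $\{(k-1)',k-1\}$, if any, is $k-1$. The word is amenable if it is $k$-amenable for all $k>1$; a tableau is amenable if its reading word is. $f^\lambda_{\mu\nu}$ is the number of amenable tableaux of shape $D_{\lambda/\mu}$ and content $\nu$. *)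

(* Defs.v *)
From mathcomp Require Import all_boot.
From mathcomp Require Import finmap.
From mathcomp Require Import boolp classical_sets functions cardinality.

Set Implicit Arguments.
Unset Strict Implicit.
Unset Printing Implicit Defensive.

Local Open Scope fset_scope.
Local Open Scope nat_scope.

(* Partitions with distinct parts; [nth 0 la i.-1] is the part lambda_i. *)
Definition is_DP (la : seq nat) : bool := sorted gtn la && all (ltn 0) la.

Definition add_one_to_first (nu : seq nat) : seq nat :=
  if nu is n :: s then n.+1 :: s else [:: 1].

(* A box (i, j) is in row i (counted downwards) and column j. *)
Definition box : Type := (nat * nat)%type.
Definition diagram : Type := {fset box}.

(* [iota i (nth 0 la i.-1)] lists the j with i <= j <= i + lambda_i - 1. *)
Definition shifted_diagram (la : seq nat) : diagram :=
  [fset x in [seq (i, j) | i <- iota 1 (size la), j <- iota i (nth 0 la i.-1)]].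

Definition skew_diagram (la mu : seq nat) : diagram :=
  shifted_diagram la `\` shifted_diagram mu.

Definition translate (p : box) (A : diagram) : diagram :=
  [fset (x.1 + p.1, x.2 + p.2) | x in A].

(* Boxes have coordinates in nat, so a translation by an integer vector p - q
   from A to B is written A + p = B + q. *)
Definition same_shape (A B : diagram) : Prop :=
  exists p q : box, translate p A = translate q B.

Definition uppermost_in_column (A : diagram) (c a : nat) : Prop :=
  (a, c) \in A /\ forall i, (i, c) \in A -> a <= i.

Definition gamma_down (b : nat) (A : diagram) : diagram :=
  [fset (if x.2 < b then (x.1.+1, x.2) else x) | x in A].

(* (k, false) stands for the letter k and (k, true) for the marked letter k'. *)
Definition letter : Type := (nat * bool)%type.

Definition letter_le (x y : letter) : bool :=
  (x.1 < y.1) || ((x.1 == y.1) && (y.2 ==> x.2)).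

Definition filling (A : diagram) : Type := {ffun A -> letter}.

Definition is_tableau (A : diagram) (T : filling A) : Prop :=
  [/\ forall x, 0 < (T x).1,
      forall x y : A, (val x).1 = (val y).1 -> (val x).2 <= (val y).2 ->
        letter_le (T x) (T y),
      forall x y : A, (val x).2 = (val y).2 -> (val x).1 <= (val y).1 ->
        letter_le (T x) (T y),
      forall (k : nat) (x y : A), (val x).2 = (val y).2 ->
        T x = (k, false) -> T y = (k, false) -> x = y
    & forall (k : nat) (x y : A), (val x).1 = (val y).1 ->
        T x = (k, true) -> T y = (k, true) -> x = y].

Definition has_content (A : diagram) (T : filling A) (nu : seq nat) : Prop :=
  forall i, 0 < i -> #|[set x : A | (T x).1 == i]| = nth 0 nu i.-1.

Definition reading_le (x y : box) : bool :=
  (y.1 < x.1) || ((x.1 == y.1) && (x.2 <= y.2)).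

Definition reading_word (A : diagram) (T : filling A) : seq letter :=
  [seq T x | x <- sort (fun x y : A => reading_le (val x) (val y)) (enum {: A})].

(* The statistic m_i(j) of a word w = w_1 ... w_n. *)
Definition mstat (w : seq letter) (i j : nat) : nat :=
  let n := size w in
  if j <= n then count_mem (i, false) (drop (n - j) w)
  else count_mem (i, false) w + count_mem (i, true) (take (j - n) w).

(* w_j, for 1 <= j <= size w; the default value is never used below. *)
Definition word_nth (w : seq letter) (j : nat) : letter := nth (0, false) w j.-1.

Definition leftmost_unmarked (w : seq letter) (k : nat) : Prop :=
  forall x s, [seq y <- w | y.1 == k] = x :: s -> x = (k, false).

Definition k_amenable (k : nat) (w : seq letter) : Prop :=
  let n := size w in
  [/\ forall j, j < n -> mstat w k j = mstat w k.-1 j ->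
        word_nth w (n - j) \notin [:: (k, false); (k, true)],
      forall j, n <= j < n + n -> mstat w k j = mstat w k.-1 j ->
        word_nth w (j - n + 1) \notin [:: (k.-1, false); (k, true)],
      leftmost_unmarked w k
    & leftmost_unmarked w k.-1].

Definition amenable (w : seq letter) : Prop := forall k, 1 < k -> k_amenable k w.

Definition amenable_tableaux (A : diagram) (nu : seq nat) : set (filling A) :=
  [set T | [/\ is_tableau T, amenable (reading_word T) & has_content T nu]]%classic.
Arguments amenable_tableaux : clear implicits.

(* [fset_set] is the empty set on infinite sets, but the sets used here are
   finite. *)
Lemma finite_amenable_tableaux (A : diagram) (nu : seq nat) :
  finite_set (amenable_tableaux A nu).
Proof.
pose n := (size nu).+1.
pose g (F : {ffun A -> 'I_n * bool}) : filling A :=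
  [ffun x => (nat_of_ord (F x).1, (F x).2)].
apply: (@sub_finite_set _ _ (g @` setT)%classic); last first.
  by apply: finite_image; exact: finite_finset.
move=> T [_ _ cT]; exists [ffun x => (inord (T x).1, (T x).2)] => //.
apply/ffunP => x; rewrite !ffunE /= inordK; first by case: (T x).
rewrite ltnS leqNgt; apply/negP => lt_nu.
have i0 : 0 < (T x).1 by apply: leq_ltn_trans lt_nu.
have := cT _ i0; rewrite nth_default; last by rewrite -ltnS prednK.
by move/eqP; rewrite cards_eq0 => /eqP/setP/(_ x); rewrite !inE eqxx.
Qed.

Definition f_coef (la mu nu : seq nat) : nat :=
  #|` fset_set (amenable_tableaux (skew_diagram la mu) nu)|.

(* Main.v *)
(* Slide the boxes of D left of column b one row down, keeping their letters,
   and put in the new box (a, b-1) the letter 1' if the box below it contains 1'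
   or 1, and 1 otherwise.  In the reading word this only exchanges, for each i,
   the left part of row i with the right part of row i+1.  Letters in the former
   are smaller in absolute value than those in the latter, so amenability can
   only be endangered by letters k-1 on the left of row i and k', k on the right
   of row i+1.  Then the letters k-1 above these k', k, which are read before
   them, keep the number of k-1 ahead of the number of k.  The inserted 1' or 1
   only helps, and T is recovered by forgetting it. *)

Require Import Defs.
From mathcomp Require Import all_boot finmap.
From mathcomp Require boolp classical_sets cardinality.
From mathcomp Require Import zify.

Set Implicit Arguments.
Unset Strict Implicit.
Unset Printing Implicit Defensive.

Local Open Scope fset_scope.
Local Open Scope nat_scope.

(** * Amenability of a word through its splittings *)

Definition amenable_splits (k : nat) (w : seq letter) : Prop :=
  [/\ forall u x v, w = u ++ x :: v -> x.1 = k ->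
        count_mem (k, false) v < count_mem (k.-1, false) v,
      forall u x v, w = u ++ x :: v -> x \in [:: (k.-1, false); (k, true)] ->
        count_mem (k, false) w + count_mem (k, true) u
          < count_mem (k.-1, false) w + count_mem (k.-1, true) u,
      forall u v, w = u ++ (k, true) :: v -> (k, false) \in u
    & forall u v, w = u ++ (k.-1, true) :: v -> (k.-1, false) \in u].

Lemma leftmost_unmarkedP (w : seq letter) (k : nat) :
  leftmost_unmarked w k <->
  forall u v, w = u ++ (k, true) :: v -> (k, false) \in u.
Proof.
rewrite /leftmost_unmarked; split => [h u v wE|].
  move: h; rewrite wE filter_cat /= eqxx.
  case fu: [seq y <- u | y.1 == k] => [|y s] h; first by have := h _ _ erefl.
  have <- : y = (k, false) by apply: h.
  have : y \in [seq y <- u | y.1 == k] by rewrite fu mem_head.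
  by rewrite mem_filter => /andP[].
elim: w => //= y w IH h x s; case: eqP => yk.
  case=> <- _; case: y yk h => y [] /= <- h //.
  by have := h [::] w erefl.
move=> /(IH _); apply => u v wE; have := h (y :: u) v; rewrite wE => /(_ erefl).
by rewrite inE => /orP[/eqP yE|//]; case: yk; rewrite -yE.
Qed.

Lemma mstat_unmarked (u v : seq letter) (i : nat) :
  mstat (u ++ v) i (size v) = count_mem (i, false) v.
Proof.
by rewrite /mstat size_cat leq_addl addnK drop_size_cat.
Qed.

Lemma mstat_marked (u v : seq letter) (i : nat) :
  mstat (u ++ v) i (size (u ++ v) + size u) =
  count_mem (i, false) (u ++ v) + count_mem (i, true) u.
Proof.
rewrite /mstat -{2}[size (u ++ v)]addn0 leq_add2l leqn0 addKn.
(* For empty [u] the index equals [size (u ++ v)] and falls into the other branch of [mstat], which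
   gives the same value. *)
case: u => [|x u]; last by rewrite /= take_size_cat.
by rewrite addn0 subnn drop0 addn0.
Qed.

Lemma word_nth_cat (u v : seq letter) (x : letter) :
  word_nth (u ++ x :: v) (size u).+1 = x.
Proof. by rewrite /word_nth /= nth_cat ltnn subnn. Qed.

Lemma split_word (w : seq letter) (i : nat) : i < size w ->
  exists u x v, w = u ++ x :: v /\ size u = i.
Proof.
move=> iw; exists (take i w), (nth (0, false) w i), (drop i.+1 w).
by rewrite -drop_nth // cat_take_drop size_takel // ltnW.
Qed.

(* The literal k-amenability conditions; [amenable_splits] replaces m_k <> m_(k-1)
   by m_k < m_(k-1), which is equivalent since both counts start at 0. *)
Definition amenable_neq (k : nat) (w : seq letter) : Prop :=
  [/\ forall u x v, w = u ++ x :: v -> 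
        count_mem (k, false) v = count_mem (k.-1, false) v -> x.1 != k,
      forall u x v, w = u ++ x :: v -> 
        count_mem (k, false) w + count_mem (k, true) u
          = count_mem (k.-1, false) w + count_mem (k.-1, true) u ->
        x \notin [:: (k.-1, false); (k, true)],
      forall u v, w = u ++ (k, true) :: v -> (k, false) \in u
    & forall u v, w = u ++ (k.-1, true) :: v -> (k.-1, false) \in u].

(** An index j of condition (a) corresponds to the split with [size v = j], an index j of (b) to the
    one with [size u = j - size w]; in both, [x] is the letter that the condition inspects. *)
Lemma k_amenable_neqP (k : nat) (w : seq letter) :
  k_amenable k w <-> amenable_neq k w.
Proof.
rewrite /k_amenable /amenable_neq.
have mk (x : letter) : (x \notin [:: (k, false); (k, true)]) = (x.1 != k).
  by case: x => i m; rewrite !inE !xpair_eqE; case: m; case: eqP.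
split=> -[h1 h2 /leftmost_unmarkedP h3 /leftmost_unmarkedP h4]; split=> //.
- move=> u x v wE cE; move: (h1 (size v)).
  rewrite wE -cat_rcons !mstat_unmarked cat_rcons size_cat /= cE.
  rewrite addnS ltnS leq_addl -addSn addnK word_nth_cat mk; exact.
- move=> u x v wE cE; move: (h2 (size w + size u)).
  rewrite wE !mstat_marked -wE cE addKn addn1 wE word_nth_cat; apply => //.
  rewrite leq_addr ltn_add2l size_cat /=; lia.
- move=> j jn; have [|u [x [v [wE us]]]] := @split_word w (size w - j).-1.
    by lia.
  have js : j = size v by have := congr1 size wE; rewrite size_cat /=; lia.
  rewrite js {1 2}wE -cat_rcons !mstat_unmarked => /h1-/(_ _ _ wE).
  rewrite mk; have -> : size w - size v = (size u).+1 by lia.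
  by rewrite wE word_nth_cat.
- move=> j /andP[nj jn].
  have [|u [x [v [wE us]]]] := @split_word w (j - size w); first by lia.
  have -> : j = size w + size u by lia.
  rewrite {1 2 3 4}wE !mstat_marked -wE => /h2-/(_ _ _ wE).
  by rewrite addKn addn1 wE word_nth_cat.
Qed.

(** Reading one more letter raises each count by at most one, so k could overtake k-1 only from a
    tie, and at a tie the first condition forbids reading k. *)
Lemma amenable_neq_suffix (k : nat) (u v : seq letter) : 0 < k ->
  amenable_neq k (u ++ v) -> count_mem (k, false) v <= count_mem (k.-1, false) v.
Proof.
move=> k0 [h _ _ _]; elim: v u h => //= x v IH u h.
have := IH (rcons u x); rewrite cat_rcons => /(_ h).
rewrite leq_eqVlt => /orP[/eqP cE|]; last by move=> /= ?; do 2 case: (x == _); lia.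
by have := h _ _ _ erefl cE; case: (eqVneq x (k, false)) => [->|_]; rewrite ?eqxx //=; lia.
Qed.

(** The tie argument again, for the second pass over the marked letters; it starts from the whole
    word, where [amenable_neq_suffix] applies. *)
Lemma amenable_neq_prefix (k : nat) (u v : seq letter) : 0 < k ->
  amenable_neq k (u ++ v) ->
  count_mem (k, false) (u ++ v) + count_mem (k, true) u
    <= count_mem (k.-1, false) (u ++ v) + count_mem (k.-1, true) u.
Proof.
move=> k0 hw; elim/last_ind: u v hw => [|u x IH] v hw.
  by rewrite !addn0; apply: (amenable_neq_suffix (u := [::])).
move: (hw); rewrite cat_rcons => hw'; have := IH _ hw'.
rewrite -cats1 !(count_cat _ u [:: x]) /= !addn0.
rewrite leq_eqVlt => /orP[/eqP cE|]; last first.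
  move=> lt_cnt; rewrite !addnA; apply: leq_trans (leq_addr _ _).
  by apply: leq_trans lt_cnt; rewrite -addn1 leq_add2l leq_b1.
have [_ h2 _ _] := hw'; have := h2 _ _ _ erefl cE.
by case: (eqVneq x (k, true)) => [->|_]; rewrite ?inE ?eqxx ?orbT //= addn0 cE addnA leq_addr.
Qed.

Lemma k_amenableP (k : nat) (w : seq letter) : 0 < k ->
  k_amenable k w <-> amenable_splits k w.
Proof.
move=> k0; rewrite k_amenable_neqP; split=> [hw|[h1 h2 h3 h4]]; last first.
  split=> // u x v wE.
    by move=> cE; apply/eqP => /(h1 _ _ _ wE); rewrite cE ltnn.
  by move=> cE; apply/negP => /(h2 _ _ _ wE); rewrite cE ltnn.
have [h1 h2 h3 h4] := hw; split=> // u x v wE hx.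
  have : amenable_neq k (rcons u x ++ v) by rewrite cat_rcons -wE.
  move/(amenable_neq_suffix k0); rewrite leq_eqVlt => /orP[/eqP cE|//].
  by have := h1 _ _ _ wE cE; rewrite hx eqxx.
move: hw; rewrite wE => /(amenable_neq_prefix k0).
rewrite leq_eqVlt => /orP[/eqP cE|//].
by rewrite -wE in cE; have := h2 _ _ _ wE cE; rewrite hx.
Qed.

(** * Amenability in terms of boxes *)

Definition reading_lt (x y : box) : bool :=
  (y.1 < x.1) || ((x.1 == y.1) && (x.2 < y.2)).

(** Predicates take the place of positions: [reading_lt x] selects the letters to the right of [x]
    in the word, [reading_lt^~ x] those to its left. Counts before and after sliding can then be
    compared box by box. *)
Definition stat (s : seq box) (t : box -> letter) (P : pred box) (c : letter) :=
  count (fun z => P z && (t z == c)) s.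

(* [amenable_splits] for the word read off the boxes in [s], whose order in the
   sequence is immaterial. *)
Definition amenable_boxes (k : nat) (s : seq box) (t : box -> letter) : Prop :=
  [/\ forall x, x \in s -> (t x).1 = k ->
        stat s t (reading_lt x) (k, false)
          < stat s t (reading_lt x) (k.-1, false),
      forall x, x \in s -> t x \in [:: (k.-1, false); (k, true)] ->
        stat s t predT (k, false) + stat s t (reading_lt^~ x) (k, true)
          < stat s t predT (k.-1, false)
            + stat s t (reading_lt^~ x) (k.-1, true),
      forall x, x \in s -> t x = (k, true) ->
        exists2 y, y \in s & reading_lt y x && (t y == (k, false))
    & forall x, x \in s -> t x = (k.-1, true) ->
        exists2 y, y \in s & reading_lt y x && (t y == (k.-1, false))].

Lemma reading_lt_irr : irreflexive reading_lt.
Proof. by move=> x; rewrite /reading_lt !ltnn andbF. Qed.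

Lemma reading_lt_trans : transitive reading_lt.
Proof. move=> y x z; rewrite /reading_lt; lia. Qed.

Lemma reading_lt_asym x y : reading_lt x y -> reading_lt y x = false.
Proof. rewrite /reading_lt; lia. Qed.

Lemma reading_le_total : total reading_le.
Proof. move=> x y; rewrite /reading_le; lia. Qed.

Lemma reading_le_trans : transitive reading_le.
Proof. move=> y x z; rewrite /reading_le; lia. Qed.

Lemma pairwise_reading_sort (s : seq box) :
  uniq s -> pairwise reading_lt (sort reading_le s).
Proof.
move=> us; have : pairwise [rel x y | (x != y) && reading_le x y]
                    (sort reading_le s).
  rewrite pairwise_relI -uniq_pairwise sort_uniq us /=.
  rewrite -sorted_pairwise; last exact: reading_le_trans.
  exact: sort_sorted reading_le_total _.
apply: sub_pairwise => -[i j] [i' j'] /=.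
rewrite xpair_eqE /reading_le /reading_lt /=; lia.
Qed.

Lemma perm_stat (s1 s2 : seq box) (t : box -> letter) (P : pred box) c :
  perm_eq s1 s2 -> stat s1 t P c = stat s2 t P c.
Proof. by move/permP; apply. Qed.

Lemma eq_stat (s : seq box) (t : box -> letter) (P Q : pred box) (c : letter) :
  P =1 Q -> stat s t P c = stat s t Q c.
Proof. by move=> PQ; apply: eq_count => z /=; rewrite PQ. Qed.

Lemma amenable_boxes_perm (k : nat) (s1 s2 : seq box) (t : box -> letter) :
  perm_eq s1 s2 -> amenable_boxes k s1 t -> amenable_boxes k s2 t.
Proof.
move=> e [h1 h2 h3 h4]; have m := perm_mem e.
split=> x; rewrite -m => xs tx.
- by rewrite -!(perm_stat t _ _ e); apply: h1.
- by rewrite -!(perm_stat t _ _ e); apply: h2.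
- by have [y ys yx] := h3 x xs tx; exists y; rewrite -?m.
- by have [y ys yx] := h4 x xs tx; exists y; rewrite -?m.
Qed.

Lemma stat_before (u v : seq box) (x : box) (t : box -> letter) c :
  pairwise reading_lt (u ++ x :: v) ->
  stat (u ++ x :: v) t (reading_lt^~ x) c = count_mem c (map t u).
Proof.
rewrite pairwise_cat /= allrel_consr => /and3P[/andP[ux _] _ /andP[xv _]].
rewrite /stat count_cat count_map /= reading_lt_irr /=.
rewrite [X in _ + X](@eq_in_count _ _ pred0) ?count_pred0 ?addn0; last first.
  by move=> z /(allP xv)/= /reading_lt_asym->.
by apply: eq_in_count => z /(allP ux)/= ->.
Qed.

Lemma stat_after (u v : seq box) (x : box) (t : box -> letter) c :
  pairwise reading_lt (u ++ x :: v) ->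
  stat (u ++ x :: v) t (reading_lt x) c = count_mem c (map t v).
Proof.
rewrite pairwise_cat /= allrel_consr => /and3P[/andP[ux _] _ /andP[xv _]].
rewrite /stat count_cat count_map /= reading_lt_irr /=.
rewrite (@eq_in_count _ _ pred0) ?count_pred0 ?add0n; last first.
  by move=> z /(allP ux)/= /reading_lt_asym->.
by apply: eq_in_count => z /(allP xv)/= ->.
Qed.

Lemma stat_predT (s : seq box) (t : box -> letter) c :
  stat s t predT c = count_mem c (map t s).
Proof. by rewrite /stat count_map; apply: eq_count. Qed.

Lemma map_eq_cat (S U : Type) (f : S -> U) (s : seq S) (u v : seq U) (x : U) :
  map f s = u ++ x :: v ->
  exists u' x' v', [/\ s = u' ++ x' :: v', map f u' = u, f x' = x & map f v' = v].
Proof.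
elim: u s => [|y u IH] [|z s] //= [].
  by move=> fz fs; exists [::], z, s.
by move=> fz /IH[u' [x' [v' [-> <- <- <-]]]]; exists (z :: u'), x', v'; rewrite -fz.
Qed.

Lemma amenable_boxesP (k : nat) (s : seq box) (t : box -> letter) :
  pairwise reading_lt s -> 0 < k ->
  k_amenable k (map t s) <-> amenable_boxes k s t.
Proof.
move=> ps k0; rewrite k_amenableP //; split=> -[h1 h2 h3 h4].
  have marked c : (forall u v, map t s = u ++ (c, true) :: v -> (c, false) \in u) ->
      forall x, x \in s -> t x = (c, true) ->
      exists2 y, y \in s & reading_lt y x && (t y == (c, false)).
    move=> h x /[dup] xs; case/splitPr: xs ps h => u v ps h _ tx.
    have := h (map t u) (map t v); rewrite map_cat /= tx => /(_ erefl).
    case/mapP=> y yu ty; exists y; first by rewrite mem_cat yu.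
    move: ps; rewrite pairwise_cat allrel_consr ty eqxx andbT.
    by case/and3P=> /andP[/allP/(_ _ yu)].
  split; try exact: marked; move=> x /splitPr xs; case: xs ps h1 h2.
    move=> u v ps h _ tx; rewrite !stat_after //.
    by apply: (h (map t u) (t x)) => //; rewrite map_cat.
  move=> u v ps _ h tx; rewrite !stat_before // !stat_predT.
  by apply: (h _ (t x) (map t v)) => //; rewrite map_cat.
have marked c : (forall x, x \in s -> t x = (c, true) ->
      exists2 y, y \in s & reading_lt y x && (t y == (c, false))) ->
    forall u v, map t s = u ++ (c, true) :: v -> (c, false) \in u.
  move=> h u0 v0 E; have [u [x [v [sE <- tx _]]]] := map_eq_cat E.
  have xs : x \in s by rewrite sE mem_cat mem_head orbT.
  have [y ys /andP[yx /eqP ty]] := h x xs tx.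
  rewrite -ty map_f //; move: ys ps; rewrite sE mem_cat inE.
  case/or3P=> [//|/eqP yE|yv]; first by rewrite yE reading_lt_irr in yx.
  rewrite pairwise_cat /= => /and3P[_ _ /andP[/allP/(_ _ yv)]].
  by move/reading_lt_asym; rewrite yx.
split; try exact: marked.
  move=> u0 x0 v0 E; have [u [x [v [sE _ <- <-]]]] := map_eq_cat E => tx.
  rewrite -!(stat_after (u := u) (x := x)) -?sE //.
  by apply: h1; rewrite // sE mem_cat mem_head orbT.
move=> u0 x0 v0 E; have [u [x [v [sE <- <- _]]]] := map_eq_cat E => tx.
have before c : count_mem c (map t u) = stat s t (reading_lt^~ x) c.
  by rewrite sE stat_before // -sE.
rewrite !before -!stat_predT.
by apply: h2; rewrite // sE mem_cat mem_head orbT.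
Qed.

(** * Initial and final segments of the reading order *)

Definition initial_in (s : seq box) (P : pred box) : Prop :=
  forall y z, y \in s -> z \in s -> reading_lt y z -> P z -> P y.

Lemma filter_initial (s : seq box) (P : pred box) :
  pairwise reading_lt s -> initial_in s P ->
  s = filter P s ++ filter (predC P) s.
Proof.
elim: s => //= x s IH /andP[xs ps] hP.
have {}IH : s = filter P s ++ filter (predC P) s.
  apply: IH => // y z ys zs; apply: hP; by rewrite inE ?ys ?zs orbT.
case: ifP => Px /=; first by rewrite -IH.
rewrite (@eq_in_filter _ P pred0) ?filter_pred0 /=; last first.
  move=> z zs; apply/negbTE/negP => Pz; move/negP: Px; apply.
  by apply: (hP x z); rewrite ?mem_head ?inE ?zs ?orbT ?(allP xs).
congr (_ :: _); rewrite {1}IH (@eq_in_filter _ P pred0) ?filter_pred0 //.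
move=> z zs; apply/negbTE/negP => Pz; move/negP: Px; apply.
by apply: (hP x z); rewrite ?mem_head ?inE ?zs ?orbT ?(allP xs).
Qed.

Lemma stat_filter (s : seq box) (t : box -> letter) (P : pred box) c :
  stat s t P c = count_mem c (map t (filter P s)).
Proof.
by rewrite /stat count_map count_filter; apply: eq_count => z /=; rewrite andbC.
Qed.

(** An initial set of boxes is read as a prefix of the word. The weak inequality serves at the
    inserted box, for which the original tableau gives no strict one. *)
Lemma stat_initial_le (k : nat) (s : seq box) (t : box -> letter) P :
  pairwise reading_lt s -> 0 < k -> k_amenable k (map t s) -> initial_in s P ->
  stat s t predT (k, false) + stat s t P (k, true)
    <= stat s t predT (k.-1, false) + stat s t P (k.-1, true).
Proof.
move=> ps k0 /k_amenable_neqP hw hP; move: hw.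
rewrite !stat_predT ![stat s t P _]stat_filter.
rewrite {1 2 4}(filter_initial ps hP) map_cat => hw.
exact: amenable_neq_prefix hw.
Qed.

Lemma stat_final_le (k : nat) (s : seq box) (t : box -> letter) P :
  pairwise reading_lt s -> 0 < k -> k_amenable k (map t s) ->
  initial_in s (predC P) ->
  stat s t P (k, false) <= stat s t P (k.-1, false).
Proof.
move=> ps k0 /k_amenable_neqP hw hP; move: hw.
rewrite ![stat s t P _]stat_filter {1}(filter_initial ps hP) map_cat.
rewrite (@eq_filter _ (predC (predC P)) P); last by move=> z /=; rewrite negbK.
exact: amenable_neq_suffix.
Qed.

Lemma reading_wordE (A : diagram) (T : filling A) (t : box -> letter) :
  (forall x : A, T x = t (val x)) ->
  reading_word T = map t (sort reading_le (enum_fset A)).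
Proof.
move=> Tt; rewrite enum_fsetE sort_map -map_comp.
by apply: eq_map => x; rewrite Tt.
Qed.

Lemma k_amenable_readingP (A : diagram) (T : filling A) (t : box -> letter) k :
  (forall x : A, T x = t (val x)) -> 0 < k ->
  k_amenable k (reading_word T) <-> amenable_boxes k (enum_fset A) t.
Proof.
move=> Tt k0; rewrite (reading_wordE Tt).
have us : uniq (enum_fset A) by [].
rewrite (amenable_boxesP t (pairwise_reading_sort us) k0).
by split; apply: amenable_boxes_perm; rewrite ?perm_sort // perm_sym perm_sort.
Qed.

(** * Tableaux as functions on boxes, and their translations *)

Definition shift (p x : box) : box := (x.1 + p.1, x.2 + p.2).

Definition tableau_boxes (s : seq box) (t : box -> letter) : Prop :=
  [/\ forall x, x \in s -> 0 < (t x).1,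
      forall x y, x \in s -> y \in s -> x.1 = y.1 -> x.2 <= y.2 ->
        letter_le (t x) (t y),
      forall x y, x \in s -> y \in s -> x.2 = y.2 -> x.1 <= y.1 ->
        letter_le (t x) (t y),
      forall k x y, x \in s -> y \in s -> x.2 = y.2 ->
        t x = (k, false) -> t y = (k, false) -> x = y
    & forall k x y, x \in s -> y \in s -> x.1 = y.1 ->
        t x = (k, true) -> t y = (k, true) -> x = y].

(** Functions on all boxes, looked at on a list, replace fillings of type [filling A]: sliding,
    inserting and translating then leave the type of [t] unchanged. *)
Definition amenable_tableau_boxes (nu : seq nat) (s : seq box)
    (t : box -> letter) : Prop :=
  [/\ tableau_boxes s t,
      forall k, 1 < k -> amenable_boxes k s t
    & forall i, 0 < i -> count (fun x => (t x).1 == i) s = nth 0 nu i.-1].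

Lemma amenable_tableauxP (A : diagram) (T : filling A) (t : box -> letter) nu :
  (forall x : A, T x = t (val x)) ->
  amenable_tableaux A nu T <-> amenable_tableau_boxes nu (enum_fset A) t.
Proof.
move=> Tt; rewrite /amenable_tableaux /= /amenable_tableau_boxes.
have cntE i : #|[set x : A | (T x).1 == i]| =
    count (fun x => (t x).1 == i) (enum_fset A).
  rewrite cardE size_filter enum_fsetE count_map enumT.
  by apply: eq_count => x /=; rewrite inE Tt.
have tabE : is_tableau T <-> tableau_boxes (enum_fset A) t.
  split=> -[h1 h2 h3 h4 h5]; split.
  - by move=> x xA; have := h1 [` xA]; rewrite Tt.
  - by move=> x y xA yA; have := h2 [` xA] [` yA]; rewrite !Tt.
  - by move=> x y xA yA; have := h3 [` xA] [` yA]; rewrite !Tt.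
  - move=> k x y xA yA; have := h4 k [` xA] [` yA]; rewrite !Tt /= => h xy tx ty.
    exact: (congr1 val (h xy tx ty)).
  - move=> k x y xA yA; have := h5 k [` xA] [` yA]; rewrite !Tt /= => h xy tx ty.
    exact: (congr1 val (h xy tx ty)).
  - by move=> x; rewrite Tt; apply: h1; apply: valP.
  - by move=> x y; rewrite !Tt; apply: h2; apply: valP.
  - by move=> x y; rewrite !Tt; apply: h3; apply: valP.
  - move=> k x y; rewrite !Tt => xy tx ty.
    by apply: val_inj; apply: (h4 k) => //; apply: valP.
  - move=> k x y; rewrite !Tt => xy tx ty.
    by apply: val_inj; apply: (h5 k) => //; apply: valP.
split=> -[h1 h2 h3]; split; try exact/tabE.
- move=> k k1; apply/(k_amenable_readingP Tt (ltnW k1)); exact: h2.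
- by move=> i i0; rewrite -cntE; apply: h3.
- move=> k k1; apply/(k_amenable_readingP Tt (ltnW k1)); exact: h2.
- by move=> i i0; rewrite cntE; apply: h3.
Qed.

Lemma amenable_tableau_boxes_perm nu (s1 s2 : seq box) (t : box -> letter) :
  perm_eq s1 s2 ->
  amenable_tableau_boxes nu s1 t -> amenable_tableau_boxes nu s2 t.
Proof.
move=> e [[h1 h2 h3 h4 h5] ha hc]; have m := perm_mem e.
split; last by move=> i /hc <-; apply/esym/(permP e).
  split=> [x|x y|x y|k x y|k x y]; rewrite -!m; first exact: h1.
  - exact: h2.
  - exact: h3.
  - exact: h4.
  - exact: h5.
by move=> k /ha; apply: amenable_boxes_perm.
Qed.

Lemma shift_inj (p : box) : injective (shift p).
Proof. by move=> [i j] [i' j'] [/addIn-> /addIn->]. Qed.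

Lemma reading_lt_shift (p x y : box) :
  reading_lt (shift p x) (shift p y) = reading_lt x y.
Proof. by rewrite /reading_lt /= !ltn_add2r eqn_add2r. Qed.

Lemma stat_shift (p : box) (s : seq box) (t : box -> letter) (P : pred box) c :
  stat (map (shift p) s) t P c = stat s (t \o shift p) (P \o shift p) c.
Proof. by rewrite /stat count_map. Qed.

Lemma amenable_boxes_shift k (p : box) (s : seq box) (t : box -> letter) :
  amenable_boxes k (map (shift p) s) t <-> amenable_boxes k s (t \o shift p).
Proof.
have after x c : stat (map (shift p) s) t (reading_lt (shift p x)) c =
    stat s (t \o shift p) (reading_lt x) c.
  by rewrite stat_shift; apply: eq_stat => z /=; rewrite reading_lt_shift.
have before x c : stat (map (shift p) s) t (reading_lt^~ (shift p x)) c =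
    stat s (t \o shift p) (reading_lt^~ x) c.
  by rewrite stat_shift; apply: eq_stat => z /=; rewrite reading_lt_shift.
split=> -[h1 h2 h3 h4]; split.
- move=> x xs tx; rewrite -!after; apply: h1 => //; exact: map_f.
- move=> x xs tx; rewrite -!before -(stat_shift _ _ _ predT).
  by rewrite -(stat_shift _ _ _ predT); apply: h2 => //; exact: map_f.
- move=> x xs tx; have [|_ /mapP[y ys ->]] := h3 (shift p x) _ tx.
    exact: map_f.
  by rewrite reading_lt_shift; exists y.
- move=> x xs tx; have [|_ /mapP[y ys ->]] := h4 (shift p x) _ tx.
    exact: map_f.
  by rewrite reading_lt_shift; exists y.
- by move=> _ /mapP[x xs ->] tx; rewrite !after; apply: h1.
- move=> _ /mapP[x xs ->] tx; rewrite !before !(stat_shift _ _ _ predT).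
  exact: h2.
- move=> _ /mapP[x xs ->] tx; have [y ys yx] := h3 x xs tx.
  by exists (shift p y); rewrite ?map_f // reading_lt_shift.
- move=> _ /mapP[x xs ->] tx; have [y ys yx] := h4 x xs tx.
  by exists (shift p y); rewrite ?map_f // reading_lt_shift.
Qed.

Lemma tableau_boxes_shift (p : box) (s : seq box) (t : box -> letter) :
  tableau_boxes (map (shift p) s) t <-> tableau_boxes s (t \o shift p).
Proof.
split=> -[h1 h2 h3 h4 h5]; split.
- by move=> x xs; apply: h1; rewrite map_f.
- move=> x y xs ys xy le_xy; apply: h2; rewrite ?map_f //= ?xy //.
  by rewrite leq_add2r.
- move=> x y xs ys xy le_xy; apply: h3; rewrite ?map_f //= ?xy //.
  by rewrite leq_add2r.
- move=> k x y xs ys xy tx ty; apply: (@shift_inj p).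
  by apply: (h4 k); rewrite ?map_f //= xy.
- move=> k x y xs ys xy tx ty; apply: (@shift_inj p).
  by apply: (h5 k); rewrite ?map_f //= xy.
- by move=> _ /mapP[x xs ->]; apply: h1.
- move=> _ _ /mapP[x xs ->] /mapP[y ys ->] /= /addIn xy.
  by rewrite leq_add2r; apply: h2.
- move=> _ _ /mapP[x xs ->] /mapP[y ys ->] /= /addIn xy.
  by rewrite leq_add2r; apply: h3.
- move=> k _ _ /mapP[x xs ->] /mapP[y ys ->] /= /addIn xy tx ty.
  by congr shift; apply: (h4 k).
- move=> k _ _ /mapP[x xs ->] /mapP[y ys ->] /= /addIn xy tx ty.
  by congr shift; apply: (h5 k).
Qed.

Lemma amenable_tableau_boxes_shift nu p (s : seq box) (t : box -> letter) :
  amenable_tableau_boxes nu (map (shift p) s) t <->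
  amenable_tableau_boxes nu s (t \o shift p).
Proof.
split=> -[h1 h2 h3]; split; try exact/tableau_boxes_shift.
- by move=> k /h2 /amenable_boxes_shift.
- by move=> i /h3 <-; rewrite count_map.
- by move=> k /h2 /amenable_boxes_shift.
- by move=> i /h3 <-; rewrite count_map.
Qed.

(** * Geometry of skew shifted diagrams *)

Lemma mem_skew_diagram (la mu : seq nat) (i j : nat) :
  ((i, j) \in skew_diagram la mu) =
  (0 < i) && (i + nth 0 mu i.-1 <= j < i + nth 0 la i.-1).
Proof.
have mem_shifted (s : seq nat) : ((i, j) \in shifted_diagram s) =
    (0 < i) && (i <= j < i + nth 0 s i.-1).
  rewrite /shifted_diagram !inE /=; apply/allpairsPdep/idP.
    move=> [i' [j' [+ + [-> ->]]]]; rewrite !mem_iota; lia.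
  move=> /and3P[i0 ij ji]; exists i, j; rewrite !mem_iota; split=> //; last lia.
  rewrite i0 /= add1n ltnS leqNgt; apply/negP => si.
  by move: ji; rewrite nth_default; lia.
rewrite /skew_diagram inE !mem_shifted; lia.
Qed.

Lemma skew_row_convex (la mu : seq nat) (i y j z : nat) :
  (i, y) \in skew_diagram la mu -> (i, z) \in skew_diagram la mu ->
  y <= j <= z -> (i, j) \in skew_diagram la mu.
Proof. rewrite !mem_skew_diagram; lia. Qed.

(** As the parts of [la] are distinct, its row i reaches at least as far to the right as row i+1;
    [y <= j] settles the left end. *)
Lemma skew_above (la mu : seq nat) (i y j : nat) : is_DP la ->
  (i, y) \in skew_diagram la mu -> (i.+1, j) \in skew_diagram la mu ->
  y <= j -> (i, j) \in skew_diagram la mu.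
Proof.
move=> /andP[/(sortedP 0) sla _]; rewrite !mem_skew_diagram /=.
case: i => // i /=; have := sla i.
case: (ltnP i.+1 (size la)) => [_ /(_ isT)|/(nth_default 0)->]; rewrite /gtn /=; lia.
Qed.

(** * Comparing counts of letters *)

Lemma sub_stat (s : seq box) (t : box -> letter) (P Q : pred box) c :
  (forall z, z \in s -> t z = c -> P z -> Q z) -> stat s t P c <= stat s t Q c.
Proof.
move=> h; rewrite /stat.
have -> : count (fun z => P z && (t z == c)) s =
    count (predI (fun z => P z && (t z == c)) (mem s)) s.
  by apply: eq_in_count => z /= ->; rewrite andbT.
by apply: sub_count => z /= /andP[/andP[Pz /eqP tz] zs]; rewrite (h z) ?tz ?eqxx.
Qed.

Lemma stat_predU_le (s : seq box) (t : box -> letter) (P Q : pred box) c :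
  stat s t (predU P Q) c <= stat s t P c + stat s t Q c.
Proof.
rewrite /stat -count_predUI; apply: leq_trans (leq_addr _ _).
by apply: sub_count => z /=; rewrite andb_orl.
Qed.

Lemma stat_predU_disjoint (s : seq box) (t : box -> letter) (P Q : pred box) c :
  (forall z, P z -> ~~ Q z) ->
  stat s t (predU P Q) c = stat s t P c + stat s t Q c.
Proof.
move=> h; rewrite /stat -count_predUI.
rewrite [X in _ + X](@eq_count _ _ pred0) ?count_pred0 ?addn0.
  by apply: eq_count => z /=; rewrite andb_orl.
move=> z /=; case: (boolP (P z)) => //= /h /negbTE->; by rewrite andbF.
Qed.

Lemma stat_pred1 (s : seq box) (t : box -> letter) x c :
  uniq s -> x \in s -> stat s t (pred1 x) c = (t x == c).
Proof.
move=> us xs; transitivity (count (fun z => (z == x) && (t x == c)) s).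
  by apply: eq_count => z /=; case: eqP => [->|].
case: (t x == c); last by rewrite (@eq_count _ _ pred0) ?count_pred0 // => z; rewrite andbF.
rewrite (@eq_count _ _ (pred1 x)) ?count_uniq_mem ?xs // => z /=; exact: andbT.
Qed.

Lemma stat_inj_le (s : seq box) (t : box -> letter) (P Q : pred box) c d f :
  uniq s -> {in [pred z in s | P z && (t z == c)] &, injective f} ->
  (forall z, z \in s -> P z -> t z = c -> [/\ f z \in s, Q (f z) & t (f z) = d]) ->
  stat s t P c <= stat s t Q d.
Proof.
move=> us f_inj h; rewrite /stat -!size_filter -(size_map f).
apply: uniq_leq_size => [|_ /mapP[z + ->]].
  rewrite map_inj_in_uniq ?filter_uniq // => x y.
  by rewrite !mem_filter => hx hy; apply: f_inj; rewrite inE andbC.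
rewrite !mem_filter => /andP[/andP[Pz /eqP tz] /h[] // -> -> ->].
by rewrite eqxx.
Qed.

(** Sending k' to 2k and k to 2k+1 turns the order of the alphabet into that of the natural numbers,
    within reach of [lia]. *)
Lemma letter_leE (x y : letter) :
  letter_le x y = (x.1.*2 + ~~ x.2 <= y.1.*2 + ~~ y.2).
Proof. by case: x y => [i []] [j []]; rewrite /letter_le /=; lia. Qed.

(** From k-1 to k there are only k-1, k' and k, and x = k forces y = k. Where the lemma is applied,
    this last case contradicts a column condition or a known letter. *)
Lemma letter_between_pred k (x y : letter) : 0 < k ->
  letter_le (k.-1, false) x -> letter_le x y -> y.1 <= k ->
  x \in [:: (k.-1, false); (k, true)] \/ x = (k, false) /\ y = (k, false).
Proof.
case: k x y => // k [i m] [j n] _; rewrite !letter_leE !inE !xpair_eqE /=.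
case: m; case: n => /= h1 h2 h3; try by left; lia.
have [|ik] := eqVneq i k; first by left.
by right; split; congr (_, _); lia.
Qed.

(** * Sliding the left columns and inserting a box *)

Section Insertion.

Variables (D : diagram) (a b : nat) (t : box -> letter) (nu : seq nat).
Hypothesis row_convex : forall i y j z,
  (i, y) \in D -> (i, z) \in D -> y <= j <= z -> (i, j) \in D.
Hypothesis above : forall i y j,
  (i, y) \in D -> (i.+1, j) \in D -> y <= j -> (i, j) \in D.
Hypothesis b_gt0 : 0 < b.
Hypothesis a_up : uppermost_in_column D (b - 1) a.
Hypothesis T_good : amenable_tableau_boxes nu (enum_fset D) t.

Let new : box := (a, b - 1).
Let newD : new \in D. Proof. by case: a_up. Qed.

Definition slide (x : box) : box := if x.2 < b then (x.1.+1, x.2) else x.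

(* The marking bit [(t new).1 == 1] makes the letter of the new box 1' or 1; [t new]
   is the letter that ends up just below it. *)
Definition slid_filling (z : box) : letter :=
  if z == new then (1, (t new).1 == 1)
  else t (if z.2 < b then (z.1.-1, z.2) else z).

Definition slid_boxes : seq box := new :: map slide (enum_fset D).

Lemma slide_inj : injective slide.
Proof.
move=> [i j] [i' j']; rewrite /slide /=.
by case: ifP => jb; case: ifP => jb' [] *; subst => //; rewrite jb in jb'.
Qed.

(** A box landing on [new] would come from column b-1, one row above the uppermost box there. *)
Lemma slide_neq_new x : x \in D -> (slide x == new) = false.
Proof.
case: x => i j xD; apply/eqP; rewrite /slide /new /=; case: ifP => jb [ia jE].
  case: a_up => _ /(_ i); rewrite -jE xD => /(_ isT); lia.
lia.
Qed.

Lemma slid_filling_slide x : x \in D -> slid_filling (slide x) = t x.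
Proof.
move=> xD; rewrite /slid_filling slide_neq_new //; congr t.
by case: x xD => i j _; rewrite /slide /=; case: (ltnP j b) => jb /=; rewrite ?jb // ltnNge jb.
Qed.

Lemma slid_boxes_uniq : uniq slid_boxes.
Proof.
rewrite /= map_inj_uniq ?fset_uniq ?andbT; last exact: slide_inj.
by apply/mapP => -[x xD /esym/eqP]; rewrite slide_neq_new.
Qed.

Lemma stat_slid (P : pred box) c :
  stat slid_boxes slid_filling P c =
  (P new && ((1, (t new).1 == 1) == c)) + stat (enum_fset D) t (P \o slide) c.
Proof.
rewrite /stat /= count_map {1}/slid_filling eqxx; congr (_ + _).
by apply: eq_in_count => x xD /=; rewrite slid_filling_slide.
Qed.

(* Read along the row of (i, y) to column j, and then one box down: in the
   first step a marked letter, in the second an unmarked one cannot repeat. *)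
Lemma lt_letter_below i y j :
  (i, y) \in D -> (i.+1, j) \in D -> y < j -> (t (i, y)).1 < (t (i.+1, j)).1.
Proof.
move=> yD jD yj; have ijD := above yD jD (ltnW yj).
have [[_ row col unm mkd] _ _] := T_good.
have := row _ _ yD ijD erefl (ltnW yj).
have := col _ _ ijD jD erefl (leqnSn i).
rewrite !letter_leE.
case ty: (t (i, y)) => [k m]; case tj: (t (i, j)) => [k' m'].
case tx: (t (i.+1, j)) => [k'' m''] /= le2 le1.
(* If all three absolute values agreed, a marked letter at (i, j) would force a marked one at (i,
   y), and an unmarked one an unmarked one at (i+1, j); [h1] and [h2] exclude this. *)
have h1 : ~ [/\ k = k', m & m'].
  case=> kk mm mm'; move: ty tj; rewrite mm mm' -kk => ty tj.
  have [yE] := mkd _ _ _ yD ijD erefl ty tj; lia.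
have h2 : ~ [/\ k' = k'', ~~ m' & ~~ m''].
  case=> kk /negbTE mm /negbTE mm'; move: tj tx; rewrite mm mm' -kk => tj tx.
  have [iE] := unm _ _ _ ijD jD erefl tj tx; lia.
move: le1 le2 h1 h2; case: m {ty}; case: m' {tj}; case: m'' {tx} => /= le1 le2 h1 h2.
all: try lia.
all: rewrite ltnNge; apply/negP => le_k.
all: try (by apply: h1; split=> //; lia).
all: try (by apply: h2; split=> //; lia).
Qed.

(** Sliding reverses the order only for a left box of row i and a right box of row i+1, the left one
    coming first afterwards. It has the smaller absolute value by [lt_letter_below], which the last
    premise excludes. *)
Lemma reading_lt_slide x z : x \in D -> z \in D ->
  reading_lt (slide x) (slide z) -> (t z).1 <= (t x).1 -> reading_lt x z.
Proof.
case: x z => i j [i' j'] xD zD; rewrite /slide /=.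
case: ifP => jb; case: ifP => jb'; rewrite /reading_lt /=; try lia.
have [iE|] := eqVneq i' i.+1; last lia.
have jj : j < j' by lia.
by subst i'; have := lt_letter_below xD zD jj; rewrite ltnNge => /negP + _.
Qed.

(** The order is lost only for a right box of row i+1 and a left box of row i, where the box that
    came first holds the larger absolute value. *)
Lemma slide_reading_lt x z : x \in D -> z \in D ->
  reading_lt x z -> (t x).1 <= (t z).1 -> reading_lt (slide x) (slide z).
Proof.
case: x z => i j [i' j'] xD zD; rewrite /slide /=.
case: ifP => jb; case: ifP => jb'; rewrite /reading_lt /=; try lia.
have [iE|] := eqVneq i i'.+1; last lia.
have jj : j' < j by lia.
by subst i; have := lt_letter_below zD xD jj; rewrite ltnNge => /negP + _.
Qed.

(** * Amenability after sliding *)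

Lemma amenable_sort k : 1 < k ->
  k_amenable k (map t (sort reading_le (enum_fset D))).
Proof.
move=> k1; have [_ /(_ _ k1) h _] := T_good.
apply/(amenable_boxesP _ (pairwise_reading_sort (fset_uniq D)) (ltnW k1)).
by apply: amenable_boxes_perm h; rewrite perm_sym perm_sort.
Qed.

(** Condition (a) gives a strict inequality only at k' and k; this weak one is for the box (i, m) of
    [slid_after_right] when it holds k-1. *)
Lemma stat_after_le k x : 1 < k ->
  stat (enum_fset D) t (reading_lt x) (k, false)
    <= stat (enum_fset D) t (reading_lt x) (k.-1, false).
Proof.
move=> k1; have e := permEl (perm_sort reading_le (enum_fset D)).
rewrite -!(perm_stat _ _ _ e).
apply: (stat_final_le (pairwise_reading_sort (fset_uniq D)) (ltnW k1) (amenable_sort k1)).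
move=> y z _ _ yz /=; apply: contra => xy; exact: reading_lt_trans yz.
Qed.

(** Otherwise [above] puts (i, b-1) in [D], over the uppermost box of its column. Hence no left box
    slides into the row of the new box. *)
Lemma left_row_neq i j : (i, j) \in D -> j < b -> i.+1 != a.
Proof.
move=> ijD jb; apply/eqP => iE; have [aD up] := a_up.
move: aD; rewrite -iE => aD.
by have := up i (above ijD aD _); rewrite -iE ltnn => /(_ ltac:(lia)).
Qed.

(** By [left_row_neq], the boxes that end up before [new] already formed an initial set before
    sliding, so [stat_initial_le] applies. *)
Lemma stat_before_new_le k : 1 < k ->
  stat (enum_fset D) t predT (k, false)
    + stat (enum_fset D) t (fun z => reading_lt (slide z) new) (k, true)
  <= stat (enum_fset D) t predT (k.-1, false)
    + stat (enum_fset D) t (fun z => reading_lt (slide z) new) (k.-1, true).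
Proof.
move=> k1; have e := permEl (perm_sort reading_le (enum_fset D)).
rewrite -!(perm_stat _ _ _ e).
apply: (stat_initial_le (pairwise_reading_sort (fset_uniq D)) (ltnW k1) (amenable_sort k1)).
move=> [i j] [i' j'] _; rewrite mem_sort => zD; have := left_row_neq zD.
by rewrite /slide /reading_lt /=; case: ifP => jb; case: ifP => jb' /=; lia.
Qed.

(* The boxes above the entries k', k of row i+1 are filled with k-1, except
   possibly the last one, which contains k' or k-1.  From that last box on, k-1
   is strictly ahead, and the k-1 before it compensate the k to the right of
   (i+1, j). *)
Lemma slid_after_right k i j y : 1 < k -> (i.+1, j) \in D -> b <= j ->
  (t (i.+1, j)).1 = k -> (i, y) \in D -> y < b -> t (i, y) = (k.-1, false) ->
  stat (enum_fset D) t (fun z => reading_lt (slide (i.+1, j)) (slide z)) (k, false)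
    < stat (enum_fset D) t
        (fun z => reading_lt (slide (i.+1, j)) (slide z)) (k.-1, false).
Proof.
move=> k1 jD bj tj yD yb ty.
have [[_ row col unm mkd] /(_ _ k1) [am _ _ _] _] := T_good.
pose P (z : D) := ((val z).1 == i.+1) && ((t (val z)).1 == k).
have Pj : P [` jD] by rewrite /P /= tj !eqxx.
case: (arg_maxnP (fun z : D => (val z).2) Pj) => -[[i' m] mD'] /=.
move=> /andP[/= /eqP i'E /eqP tm] m_max.
have mD : (i.+1, m) \in D by rewrite -i'E.
have {}tm : (t (i.+1, m)).1 = k by rewrite -i'E.
have jm : j <= m by apply: (m_max [` jD]).
have {}m_max m' : (i.+1, m') \in D -> (t (i.+1, m')).1 = k -> m' <= m.
  move=> m'D tm'; apply: (m_max [` m'D]).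
  by rewrite /P /= tm' !eqxx.
have z0D : (i, m) \in D by apply: above yD mD _; lia.
have le_y0 : letter_le (t (i, y)) (t (i, m)) by apply: row => //=; lia.
have le_0m : letter_le (t (i, m)) (t (i.+1, m)) by apply: col => //=.
have tz0 : t (i, m) \in [:: (k.-1, false); (k, true)].
  rewrite ty in le_y0.
  have [//|[t0 t1]] := letter_between_pred (ltnW k1) le_y0 le_0m (eq_leq tm).
  by have [/n_Sn] := unm _ _ _ z0D mD erefl t0 t1.
have t_left m' : b <= m' < m -> (i, m') \in D /\ t (i, m') = (k.-1, false).
  move=> /andP[bm' m'm]; have m'D : (i, m') \in D.
    by apply: row_convex yD z0D _; rewrite (ltnW (leq_trans yb bm')) ltnW.
  split=> //.
  have le1 : letter_le (t (i, y)) (t (i, m')).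
    by apply: row => //=; apply: ltnW; apply: leq_trans bm'.
  have le2 : letter_le (t (i, m')) (t (i, m)) by apply: row => //=; apply: ltnW.
  have le3 : (t (i, m)).1 <= k.
    by move: tz0; rewrite !inE => /orP[] /eqP-> //=; apply: leq_pred.
  rewrite ty in le1.
  have [|[_ t0]] := letter_between_pred (ltnW k1) le1 le2 le3; last first.
    by move: tz0; rewrite t0 !inE !xpair_eqE andbF orbF (gtn_eqF _) // prednK // ltnW.
  rewrite !inE => /orP[/eqP//|/eqP t1]; move: tz0 le2.
  rewrite !inE => /orP[] /eqP t0; last first.
    by have [m'E] := mkd _ _ _ m'D z0D erefl t1 t0; rewrite m'E ltnn in m'm.
  by rewrite t0 t1 /letter_le /= ltnNge leq_pred andbT gtn_eqF // ltn_predL ltnW.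
(* After sliding, every k to the right of (i+1, j) in the word lies in [Q] or [A1], while all boxes
   of the disjoint sets [Q] and [A2] are to its right. So k in [Q], [A1] is to be compared with k-1
   in [Q], [A2]. *)
pose Q : pred box := predU (pred1 (i, m)) (reading_lt (i, m)).
pose A1 : pred box := fun z => (z.1 == i.+1) && (j < z.2).
pose A2 : pred box := fun z => (z.1 == i) && (b <= z.2 < m).
have slide_j : slide (i.+1, j) = (i.+1, j) by rewrite /slide /= ltnNge bj.
rewrite slide_j.
have leQ : stat (enum_fset D) t Q (k, false) < stat (enum_fset D) t Q (k.-1, false).
  have disj z : pred1 (i, m) z -> ~~ reading_lt (i, m) z.
    by move=> /= /eqP->; rewrite reading_lt_irr.
  rewrite !(stat_predU_disjoint _ _ _ disj) !stat_pred1 ?fset_uniq //.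
  (* If (i, m) holds k-1, this letter makes the weak inequality strict; if it holds k', condition
     (a) at (i, m) is strict already. *)
  move: tz0; rewrite !inE => /orP[] /eqP tz0.
    have kk : (k.-1 == k) = false by rewrite ltn_eqF // ltn_predL ltnW.
    by rewrite tz0 !xpair_eqE !eqxx kk /= add0n add1n ltnS; apply: stat_after_le.
  have tz1 : (t (i, m)).1 = k by rewrite tz0.
  by have := am _ z0D tz1; rewrite tz0 !xpair_eqE /= !andbF.
have leA : stat (enum_fset D) t A1 (k, false) <= stat (enum_fset D) t A2 (k.-1, false).
  (* Each k to the right of (i+1, j) is matched with the k-1 one row up and one column to the left.
     Moving left avoids column m, whose box (i, m) is counted in [Q] and may hold k'. *)
  apply: (stat_inj_le (f := fun z => (i, z.2.-1)) (fset_uniq D)).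
    move=> [i1 j1] [i2 j2]; rewrite !inE /A1 /=.
    move=> /and3P[_ /andP[/eqP-> j1j] _] /and3P[_ /andP[/eqP-> j2j] _] [jE].
    by rewrite -(ltn_predK j1j) jE (ltn_predK j2j).
  move=> [i1 j1] zD /andP[/= /eqP i1E jj1] tz; rewrite i1E in zD tz.
  have j1m : j1 <= m by apply: m_max; rewrite ?tz.
  have hj : b <= j1.-1 < m by clear -j1m jj1 bj; lia.
  have [-> ->] := t_left _ hj; split=> //.
  by rewrite /A2 /= eqxx hj.
have upper : stat (enum_fset D) t
    (fun z => reading_lt (i.+1, j) (slide z)) (k, false)
    <= stat (enum_fset D) t Q (k, false) + stat (enum_fset D) t A1 (k, false).
  apply: leq_trans (stat_predU_le _ _ _ _ _); apply: sub_stat => -[i1 j1] zD tz.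
  (* The boxes of row i in columns b to m-1 lie in neither set, but hold k-1 and not k. *)
  have ne : i1 = i -> b <= j1 < m -> False.
    by move=> i1E /t_left[_]; rewrite -i1E tz => -[kE]; clear -kE k1; lia.
  rewrite /Q /A1 /slide /reading_lt /= !xpair_eqE.
  clear -ne yb bj jm.
  by case: ifP => jb /=; case: (eqVneq i1 i) ne => [->|] /=; lia.
have lower : stat (enum_fset D) t Q (k.-1, false)
      + stat (enum_fset D) t A2 (k.-1, false)
    <= stat (enum_fset D) t (fun z => reading_lt (i.+1, j) (slide z)) (k.-1, false).
  rewrite -stat_predU_disjoint; last first.
    by move=> [i1 j1]; rewrite /Q /A2 /reading_lt /= xpair_eqE; clear; lia.
  apply: sub_stat => -[i1 j1] zD _.
  rewrite /Q /A2 /slide /reading_lt /= !xpair_eqE; clear -bj jm.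
  by case: ifP => jb /=; lia.
apply: leq_ltn_trans upper _; apply: leq_trans lower.
by rewrite -addSn leq_add.
Qed.

(** Sliding cannot bring a k to the right of [x]. It can move a k-1 from the right of [x] to its
    left only if [x] is in a column from b on and the k-1 is on the left of the row above; this is
    the case of [slid_after_right]. *)
Lemma slid_after k x : 1 < k -> x \in D -> (t x).1 = k ->
  stat (enum_fset D) t (fun z => reading_lt (slide x) (slide z)) (k, false)
    < stat (enum_fset D) t (fun z => reading_lt (slide x) (slide z)) (k.-1, false).
Proof.
move=> k1 xD tx; have [_ /(_ _ k1) [am _ _ _] _] := T_good.
case: x xD tx => i j xD tx.
pose L (z : D) := [&& (val z).1.+1 == i, (val z).2 < b & t (val z) == (k.-1, false)].
case: (boolP ((b <= j) && [exists z, L z])) => [/andP[bj /existsP[]]|noL].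
  move=> [[i' y] yD] /and3P[/= /eqP iE yb /eqP ty].
  move: xD tx; rewrite -iE => xD tx; exact: slid_after_right yD yb ty.
apply: leq_ltn_trans (leq_trans (am _ xD tx) _); apply: sub_stat => z zD tz h.
  by apply: reading_lt_slide; rewrite ?tz ?tx.
move: h noL; case: z zD tz => i' j' zD tz; rewrite /slide /reading_lt /=.
case: ifP => jb; case: ifP => jb' /=; try lia.
have [iE|] := eqVneq i'.+1 i; last lia.
move=> _ /negP[]; rewrite leqNgt jb' /=.
by apply/existsP; exists [` zD]; apply/and3P; split=> /=; rewrite ?iE ?tz.
Qed.

Lemma slid_before k x : 1 < k -> x \in D -> t x \in [:: (k.-1, false); (k, true)] ->
  stat (enum_fset D) t predT (k, false)
    + stat (enum_fset D) t (fun z => reading_lt (slide z) (slide x)) (k, true)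
  < stat (enum_fset D) t predT (k.-1, false)
    + stat (enum_fset D) t (fun z => reading_lt (slide z) (slide x)) (k.-1, true).
Proof.
move=> k1 xD tx; have [_ /(_ _ k1) [_ am _ _] _] := T_good.
have tx1 : k.-1 <= (t x).1 <= k.
  by move: tx; rewrite !inE => /orP[] /eqP-> /=; rewrite leqnn leq_pred.
have /andP[tx_ge tx_le] := tx1.
apply: leq_ltn_trans (leq_trans (am _ xD tx) _).
  rewrite leq_add2l; apply: sub_stat => z zD tz h.
  by apply: reading_lt_slide; rewrite ?tz.
rewrite leq_add2l; apply: sub_stat => z zD tz h.
by apply: slide_reading_lt; rewrite ?tz.
Qed.

Lemma slid_leftmost k x : x \in D -> t x = (k, true) ->
  (exists2 y, y \in enum_fset D & reading_lt y x && (t y == (k, false))) ->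
  exists2 y, y \in slid_boxes & reading_lt y (slide x) && (slid_filling y == (k, false)).
Proof.
move=> xD tx [y yD /andP[yx /eqP ty]]; exists (slide y).
  by rewrite inE map_f ?orbT.
by rewrite slid_filling_slide // ty eqxx andbT slide_reading_lt // tx ty.
Qed.

Lemma mem_slid_boxes z : z \in slid_boxes ->
  z = new \/ exists2 x, x \in D & z = slide x.
Proof.
rewrite inE => /orP[/eqP|/mapP[x xD ->]]; first by left.
by right; exists x.
Qed.

Lemma slid_filling_new : slid_filling new = (1, (t new).1 == 1).
Proof. by rewrite /slid_filling eqxx. Qed.

Lemma slide_new : slide new = (a.+1, b - 1).
Proof. by rewrite /slide /= ltn_subrL b_gt0. Qed.

Lemma amenable_slid k : 1 < k -> amenable_boxes k slid_boxes slid_filling.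
Proof.
move=> k1; have [[pos _ _ _ _] /(_ _ k1) [_ _ lm lm'] _] := T_good.
have new_k m : ((1, m) == (k, false)) = false :> bool.
  by rewrite xpair_eqE (ltn_eqF k1).
have new_k' m : ((1, m) == (k, true)) = false :> bool.
  by rewrite xpair_eqE (ltn_eqF k1).
split=> z /mem_slid_boxes[->|[x xD ->]].
- by rewrite slid_filling_new /= => k1E; rewrite k1E ltnn in k1.
- rewrite slid_filling_slide // => tx; rewrite !stat_slid new_k andbF add0n.
  exact: leq_trans (slid_after k1 xD tx) (leq_addl _ _).
(* An unmarked 1 in the new box is tested only for k = 2; being itself one more k-1, it makes
   [stat_before_new_le] strict. *)
- rewrite slid_filling_new !inE new_k' orbF => /eqP[kE tn].
  rewrite !stat_slid /= reading_lt_irr new_k -kE tn eqxx !add0n -addnA add1n ltnS.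
  have := stat_before_new_le k1; rewrite -kE; exact.
- rewrite slid_filling_slide // => tx; rewrite !stat_slid new_k new_k' !andbF !add0n.
  apply: leq_trans (slid_before k1 xD tx) _.
  by apply: leq_add; apply: leq_addl.
- by rewrite slid_filling_new => /eqP; rewrite new_k'.
- rewrite slid_filling_slide // => tx; exact: slid_leftmost xD tx (lm _ xD tx).
(* If the new box holds 1', the box below it, which comes earlier in the word, holds 1 or 1'; a 1'
   there is preceded by some 1, as [t] is amenable. *)
- rewrite slid_filling_new => -[kE /eqP tn].
  have new_lt : reading_lt (slide new) new.
    by rewrite slide_new /reading_lt /= ltnSn.
  case tE: (t new) => [n m]; rewrite tE /= in tn; rewrite tn kE in tE.
  case: m tE => tE.
    have [y ys /andP[yx ty]] := slid_leftmost newD tE (lm' _ newD tE).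
    by exists y; rewrite // ty andbT; apply: reading_lt_trans yx new_lt.
  exists (slide new); first by rewrite inE map_f ?orbT.
  by rewrite new_lt slid_filling_slide // tE eqxx.
- rewrite slid_filling_slide // => tx; exact: slid_leftmost xD tx (lm' _ xD tx).
Qed.

Lemma slid_content i : 0 < i ->
  count (fun x => (slid_filling x).1 == i) slid_boxes
    = nth 0 (add_one_to_first nu) i.-1.
Proof.
move=> i0; have [_ _ /(_ _ i0) cE] := T_good.
rewrite /= slid_filling_new count_map /=.
rewrite (@eq_in_count _ _ (fun x => (t x).1 == i)); last first.
  by move=> x xD /=; rewrite slid_filling_slide.
by rewrite cE; case: i i0 {cE} => // -[|i] _; case: nu => //=; rewrite nth_nil.
Qed.

(** * Row and column conditions after sliding *)

Lemma slide_row i j i' j' : (i, j) \in D -> (i', j') \in D ->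
  (slide (i, j)).1 = (slide (i', j')).1 -> j <= j' ->
  i = i' \/ [/\ i' = i.+1, j < b & b <= j'].
Proof.
move=> _ _; rewrite /slide /=.
case: ifP => jb; case: ifP => jb' /= iE jj; try by left; lia.
by right; split; lia.
Qed.

Lemma tableau_slid : tableau_boxes slid_boxes slid_filling.
Proof.
have [[pos row col unm mkd] _ _] := T_good.
have letter_le_refl x : letter_le x x by rewrite letter_leE.
have slide2 x : (slide x).2 = x.2 by rewrite /slide; case: ifP.
have slide1 x y : x.2 = y.2 -> (slide x).1 <= (slide y).1 -> x.1 <= y.1.
  by rewrite /slide => ->; case: ifP.
(* By [left_row_neq], the new box shares its row only with boxes of row a in columns from b on,
   which have not moved. *)
have row_new x : x \in D -> (slide x).1 = a -> x.1 = a /\ b <= x.2.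
  case: x => i j xD; rewrite /slide /=; case: ifP => jb /= iE.
    by have := left_row_neq xD jb; rewrite iE eqxx.
  by rewrite leqNgt jb.
split.
- move=> _ /mem_slid_boxes[->|[x xD ->]]; first by rewrite slid_filling_new.
  by rewrite slid_filling_slide //; apply: pos.
- move=> _ _ /mem_slid_boxes[->|[x xD ->]] /mem_slid_boxes[->|[y yD ->]].
  + by move=> _ _; apply: letter_le_refl.
  + move=> /esym/(row_new _ yD)[ya yb] _; rewrite slid_filling_new slid_filling_slide //.
    (* The inserted letter is at most [t new], the letter that stood in its place. *)
    have : letter_le (t new) (t y).
      by apply: row => //=; apply: leq_trans (leq_subr 1 b) yb.
    have := pos _ newD; have := pos _ yD; rewrite !letter_leE /=.
    case: (t new) => [n m]; case: (t y) => [n' m'] /=.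
    by case: eqP => [->|]; case: m; case: m' => /=; lia.
  + move=> /(row_new _ xD)[xa xb].
    by rewrite slide2 /= leqNgt (leq_trans _ xb) // ltn_subrL b_gt0.
  + rewrite !slide2 !slid_filling_slide //; case: x y xD yD => i j [i' j'] xD yD.
    move=> iE jj; have [ii|[ii jb bj]] := slide_row xD yD iE jj.
      by apply: row.
    subst i'; have jj' : j < j' by apply: leq_trans bj.
    by rewrite /letter_le lt_letter_below.
- move=> _ _ /mem_slid_boxes[->|[x xD ->]] /mem_slid_boxes[->|[y yD ->]].
  + by move=> _ _; apply: letter_le_refl.
  + rewrite slide2 => yE ay; rewrite slid_filling_new slid_filling_slide //.
    have : letter_le (t new) (t y).
      apply: col => //=; case: y yD yE {ay} => i j yD /= jE.
      by case: a_up => _; apply; rewrite jE.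
    have := pos _ newD; have := pos _ yD; rewrite !letter_leE /=.
    case: (t new) => [n m]; case: (t y) => [n' m'] /=.
    by case: eqP => [->|]; case: m; case: m' => /=; lia.
  + rewrite slide2 => xE; case: x xD xE => i j xD /= jE.
    have : a <= i by case: a_up => _; apply; rewrite -jE.
    by rewrite /slide jE /= ltn_subrL b_gt0 /=; lia.
  + rewrite !slide2 !slid_filling_slide // => xy; move/(slide1 _ _ xy); exact: col.
(* An unmarked 1 is inserted only when [t new] is at least 2', so no 1 occurs further down the
   column. *)
- have new_col y k : y \in D -> b - 1 = y.2 -> slid_filling new = (k, false) ->
      t y = (k, false) -> False.
    move=> yD yE; rewrite slid_filling_new => -[<- /negbT tn] ty.
    have : letter_le (t new) (t y).
      apply: col => //=; case: y yD yE {ty} => i j yD /= jE.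
      by case: a_up => _; apply; rewrite jE.
    by have := pos _ newD; rewrite ty letter_leE /=; lia.
  move=> k _ _ /mem_slid_boxes[->|[x xD ->]] /mem_slid_boxes[->|[y yD ->]] //.
  + by rewrite slide2 slid_filling_slide // => yE tn /(new_col _ _ yD yE tn).
  + by rewrite slide2 slid_filling_slide // => xE tx /(new_col _ _ xD (esym xE))/(_ tx).
  + by rewrite !slide2 !slid_filling_slide // => xy tx ty; rewrite (unm _ _ _ xD yD xy tx ty).
(* When 1' is inserted, [t new] is 1' or 1; a 1' further right would force [t new] to be 1', a
   repetition in row a of the original tableau. *)
- have new_row y k : y \in D -> (slide y).1 = a -> slid_filling new = (k, true) ->
      t y = (k, true) -> False.
    move=> yD /(row_new _ yD)[ya yb]; rewrite slid_filling_new => -[<- tn] ty.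
    have : letter_le (t new) (t y) by apply: row => //=; apply: leq_trans (leq_subr 1 b) yb.
    rewrite ty letter_leE; case tE: (t new) tn => [n m] /= /eqP nE.
    rewrite nE in tE *; case: m tE => //= tE _.
    have := mkd _ _ _ newD yD (esym ya) tE ty; move: yb; case: (y) => i j /= yb [_ jE]; lia.
  move=> k _ _ /mem_slid_boxes[->|[x xD ->]] /mem_slid_boxes[->|[y yD ->]] //.
  + by rewrite slid_filling_slide // => /esym yE tn /(new_row _ _ yD yE tn).
  + by rewrite slid_filling_slide // => xE tx /(new_row _ _ xD xE)/(_ tx).
  rewrite !slid_filling_slide // => xy tx ty; congr slide; move: xD yD xy tx ty.
  wlog: x y / x.2 <= y.2 => [hw|].
    have [le_xy|/ltnW le_yx] := leqP x.2 y.2; first exact: hw.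
    by move=> xD yD xy tx ty; apply/esym/hw.
  case: x y => i j [i' j'] /= jj xD yD xy tx ty.
  have [ii|[ii jb bj]] := slide_row xD yD xy jj; first exact: (mkd k).
  subst i'; have jj' : j < j' by apply: leq_trans bj.
  by have := lt_letter_below xD yD jj'; rewrite tx ty ltnn.
Qed.

Lemma amenable_tableau_slid :
  amenable_tableau_boxes (add_one_to_first nu) slid_boxes slid_filling.
Proof.
split; [exact: tableau_slid | exact: amenable_slid | exact: slid_content].
Qed.

End Insertion.

(** * The injection between the two sets of tableaux *)

Definition box_filling (A : diagram) (T : filling A) (z : box) : letter :=
  if insub z is Some x then T x else (0, false).

Lemma box_fillingE (A : diagram) (T : filling A) (x : A) :
  T x = box_filling T (val x).
Proof. by rewrite /box_filling valK. Qed.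

Lemma mem_translate (p : box) (A : diagram) (s : seq box) :
  s =i A -> map (shift p) s =i translate p A.
Proof.
move=> sA z; apply/mapP/imfsetP => -[x xs ->]; exists x => //; first by rewrite -sA.
by rewrite sA.
Qed.

Lemma slid_boxes_mem (D : diagram) (a b : nat) :
  slid_boxes D a b =i gamma_down b D `|` [fset (a, b - 1)].
Proof.
move=> z; rewrite !inE orbC; congr (_ || _).
by apply/mapP/imfsetP => -[x xD ->]; exists x.
Qed.

Theorem lemma3p11 (la mu : seq nat) (a b : nat) (al be : seq nat) :
  is_DP la -> is_DP mu ->
  shifted_diagram mu `<=` shifted_diagram la ->
  size la <= b ->
  uppermost_in_column (skew_diagram la mu) (b - 1) a ->
  is_DP al -> is_DP be ->
  shifted_diagram be `<=` shifted_diagram al ->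
  same_shape (gamma_down b (skew_diagram la mu) `|` [fset (a, b - 1)])
             (skew_diagram al be) ->
  forall nu : seq nat, is_DP nu ->
    f_coef la mu nu <= f_coef al be (add_one_to_first nu).
Proof.
move=> la_DP _ _ _ a_up _ _ _ [p [q shape]] nu _.
rewrite /f_coef; set B := skew_diagram al be in shape *.
have row_convex := @skew_row_convex la mu.
have above i y j := @skew_above la mu i y j la_DP.
(* For b = 0 the truncated [b - 1] would be column 0, which no shifted diagram meets. *)
have b_gt0 : 0 < b.
  by case: a_up; rewrite mem_skew_diagram; case: (b) => //; lia.
set D := skew_diagram la mu in shape a_up row_convex above *.
pose s := slid_boxes D a b.
have perm_s : perm_eq (map (shift p) s) (map (shift q) (enum_fset B)).
  apply: uniq_perm; rewrite ?(map_inj_uniq (@shift_inj _)) ?fset_uniq //.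
    exact: slid_boxes_uniq.
  move=> z; rewrite (mem_translate p (slid_boxes_mem D a b)) shape.
  by rewrite (@mem_translate q B).
(* [fill T] is meant on the slid diagram translated by [p], which is also [B] translated by [q]; the
   truncated subtractions are exact there. *)
pose fill (T : filling D) (w : box) :=
  slid_filling a b (box_filling T) (w.1 - p.1, w.2 - p.2).
have fill_shift T : fill T \o shift p = slid_filling a b (box_filling T).
  by apply: boolp.funext => -[i j]; rewrite /fill /= !addnK.
pose F (T : filling D) : filling B := [ffun x => fill T (shift q (val x))].
have F_inj : injective F.
  move=> T1 T2 /ffunP eqF; apply/ffunP => x.
  (* The letter of [T] at [x] reappears at this box, so the values of [F T] determine [T]. *)
  have : shift p (slide b (val x)) \in map (shift q) (enum_fset B).
    by rewrite -(perm_mem perm_s) map_f // inE map_f ?orbT //; apply: valP.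
  case/mapP => y yB xy; have := eqF [` yB]; rewrite !ffunE /= -xy.
  have fillE T : fill T (shift p (slide b (val x))) = T x.
    rewrite -[LHS]/((fill T \o shift p) _) fill_shift.
    by rewrite (slid_filling_slide _ b_gt0 a_up) ?box_fillingE //; apply: valP.
  by rewrite !fillE.
have F_amenable T : amenable_tableaux D nu T ->
    amenable_tableaux B (add_one_to_first nu) (F T).
  move=> /(amenable_tableauxP _ (box_fillingE T)) T_good.
  apply/(@amenable_tableauxP _ _ (fill T \o shift q)).
    by move=> x; rewrite ffunE.
  apply/amenable_tableau_boxes_shift; apply: amenable_tableau_boxes_perm perm_s _.
  apply/amenable_tableau_boxes_shift; rewrite fill_shift.
  exact: amenable_tableau_slid.
set X := cardinality.fset_set (amenable_tableaux D nu).
have -> : #|` X| = #|` [fset F T | T in X]|.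
  by rewrite card_imfset.
apply: fsubset_leq_card.
apply/fsubsetP => _ /imfsetP[T + ->] /=.
rewrite !cardinality.in_fset_set; try exact: finite_amenable_tableaux.
by rewrite !classical_sets.inE => /F_amenable.
Qed.
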